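(* Let $\mathcal{X}=\{x_1,\dots,x_m\}$ be a finite alphabet, let $n_0\ge1$ and let $\nu^{n_0}$ be an $n_0$-type on $\mathcal{X}$. Let $\mathcal{Q}\subseteq\mathcal{P}(\mathcal{X})$ be a convex, closed, rare set of sources, where rare means $\nu^{n_0}\notin\mathcal{Q}$. Let $\hat q$ be the $L$-projection of $\nu^{n_0}$ on $\mathcal{Q}$, and let $B(\hat q,\epsilon)$ be the closed $\epsilon$-ball in the total variation metric centered at $\hat q$. Assume the uniform prior on $n$-sources for each $n$. Then, for every $\epsilon>0$, as $n\to\infty$ along $n=kn_0$, $k\in\mathbb{N}$, with $\nu^n=\nu^{kn_0}$ the type $k$-equivalent to $\nu^{n_0}$, $$\lim_{k\to\infty,\ n=kn_0}\pi\big(q^n\in B(\hat q,\epsilon)\mid(q^n\in\mathcal{Q})\wedge\nu^n\big)=1.$$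
   Context: $\mathcal{P}(\mathcal{X})$ is the set of all probability mass functions (pmf's) on $\mathcal{X}$, with the topology induced from $\mathbb{R}^m$; its elements are called sources. $\mathcal{R}_n$ is the set of $n$-rational pmf's, i.e. those of the form $[n_1,\dots,n_m]/n$ with nonnegative integers $n_i$ summing to $n$. Elements of $\mathcal{R}_n$ are called $n$-types (when regarded as empirical measures of sequences of length $n$) or $n$-sources (when regarded as sources, written $q^n$). If $\nu^{n_0}=[n_1,\dots,n_m]/n_0$, the type $k$-equivalent to it is $\nu^{kn_0}=[kn_1,\dots,kn_m]/(kn_0)$, which is the same pmf. Uniform prior: $\pi(q^n)=1/N$ for all $q^n\in\mathcal{R}_n$, where $N=\binom{n+m-1}{m-1}=|\mathcal{R}_n|$. Likelihood: $\pi(\nu^n\mid q^n)=\Gamma(\nu^n)\prod_{i=1}^m(q^n_i)^{n\nu^n_i}$, with $\Gamma(\nu^n)=n!/\prod_{i=1}^m n_i!$ for $\nu^n=[n_1,\dots,n_m]/n$ (convention $0^0=1$). The posterior is given by Bayes' theorem: $\pi(q^n\mid\nu^n)=\pi(\nu^n\mid q^n)\pi(q^n)/\sum_{\tilde q\in\mathcal{R}_n}\pi(\nu^n\mid\tilde q)\pi(\tilde q)$, and $\pi(q^n\in C\mid\nu^n)=\sum_{q^n\in C\cap\mathcal{R}_n}\pi(q^n\mid\nu^n)$ for $C\subseteq\mathcal{P}(\mathcal{X})$. The conditional probability is $\pi(q^n\in B\mid(q^n\in\mathcal{Q})\wedge\nu^n)=\pi(q^n\in B\cap\mathcal{Q}\mid\nu^n)/\pi(q^n\in\mathcal{Q}\mid\nu^n)$,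 provided that $\pi(q^n\in\mathcal{Q}\mid\nu^n)>0$. For $p,q\in\mathcal{P}(\mathcal{X})$ the $L$-divergence is $L(q\|p)=\sum_{x\in\mathcal{X}}p(x)\log q(x)\in\mathbb{R}\cup\{-\infty\}$ (conventions $\log 0=-\infty$, $0\log 0=0$). The $L$-projection of $p$ on a set $\mathcal{C}$ of sources is $\hat q=\arg\sup_{q\in\mathcal{C}}L(q\|p)$.
   Formalization: Added: $\hat q$ is a limit of rational sources in $\mathcal{Q}$ (the claim is false otherwise, e.g. a segment with one rational point); $\hat q$ is the unique $L$-projection; the limit is over those $k$ with $\pi(q^n\in\mathcal{Q}\mid\nu^n)>0$. *)

(* Defs.v *)
From HB Require Import structures.
From mathcomp Require Import all_boot all_order all_algebra.
From mathcomp Require Import all_classical all_reals all_analysis.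
Set Implicit Arguments.
Unset Strict Implicit.
Unset Printing Implicit Defensive.
Import Order.TTheory GRing.Theory Num.Theory.
Import numFieldNormedType.Exports.
Local Open Scope classical_set_scope.
Local Open Scope ring_scope.

(* The alphabet {x_1, ..., x_m} is 'I_m, and a source is a row vector in R^m,
   so that the topology of 'rV[R]_m restricts to that of the simplex. *)
Definition sources (R : realType) (m : nat) : set 'rV[R]_m :=
  [set q | (forall i, 0 <= q 0 i) /\ \sum_i q 0 i = 1].
Arguments sources : clear implicits.

Definition is_counts (m n : nat) (c : 'I_m -> nat) : Prop :=
  (\sum_i c i)%N = n.

(* [c_1, ..., c_m] / n *)
Definition type_of (R : realType) (m n : nat) (c : 'I_m -> nat) : 'rV[R]_m :=
  \row_i ((c i)%:R / n%:R).

(* Meaningful for 0 < n: for n = 0 this is {0}, which contains no source. *)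
Definition n_sources (R : realType) (m n : nat) : set 'rV[R]_m :=
  [set type_of R n c | c in [set c : 'I_m -> nat | is_counts n c]].
Arguments n_sources : clear implicits.

(* The sums below range over the sets C `&` n_sources R m n; a \sum_(_ \in _)
   over a set is the actual sum only if the support is finite. *)
Lemma finite_n_sources (R : realType) (m n : nat) :
  finite_set (n_sources R m n).
Proof.
pose f (g : {ffun 'I_m -> 'I_n.+1}) : 'rV[R]_m :=
  type_of R n (fun i => g i : nat).
apply: (@sub_finite_set _ _ (f @` setT)); last exact: finite_image.
move=> _ [c hc <-]; exists [ffun i => inord (c i)] => //.
apply/rowP => i; rewrite !mxE ffunE inordK // ltnS -hc.
by rewrite (bigD1 i) //= leq_addr.
Qed.

(* Uniform prior on the n-sources, 1 / N with N = C(n + m - 1, m - 1). *)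
Definition prior (R : realType) (m n : nat) (q : 'rV[R]_m) : R :=
  \1_(n_sources R m n) q / 'C(n + m - 1, m - 1)%:R.

(* Likelihood of the n-type [c_1, ..., c_m] / n; note n * (c_i / n) = c_i. *)
Definition likelihood (R : realType) (m n : nat) (c : 'I_m -> nat)
    (q : 'rV[R]_m) : R :=
  (n`!)%:R / (\prod_i (c i)`!)%N%:R * \prod_i q 0 i ^+ c i.

Definition posterior (R : realType) (m n : nat) (c : 'I_m -> nat)
    (q : 'rV[R]_m) : R :=
  likelihood n c q * prior n q /
  \sum_(q' \in n_sources R m n) likelihood n c q' * prior n q'.

Definition posterior_set (R : realType) (m n : nat) (c : 'I_m -> nat)
    (C : set 'rV[R]_m) : R :=
  \sum_(q \in C `&` n_sources R m n) posterior n c q.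

(* Meaningful only when 0 < posterior_set n c Q. *)
Definition cond_posterior (R : realType) (m n : nat) (c : 'I_m -> nat)
    (B Q : set 'rV[R]_m) : R :=
  posterior_set n c (B `&` Q) / posterior_set n c Q.

(* L(q || p); lne 0 = -oo and 0 * -oo = 0 in \bar R. *)
Definition Ldiv (R : realType) (m : nat) (q p : 'rV[R]_m) : \bar R :=
  (\sum_i (p 0 i)%:E * lne (q 0 i)%:E)%E.

(* The set of all maximizers; q is "the" L-projection when this is [set q]. *)
Definition Lprojection (R : realType) (m : nat) (p : 'rV[R]_m)
    (C : set 'rV[R]_m) : set 'rV[R]_m :=
  [set q | C q /\ forall q', C q' -> (Ldiv q' p <= Ldiv q p)%E].

Definition tv_dist (R : realType) (m : nat) (p q : 'rV[R]_m) : R :=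
  2^-1 * \sum_i `|p 0 i - q 0 i|.

Definition tv_ball (R : realType) (m : nat) (q : 'rV[R]_m) (eps : R) :
    set 'rV[R]_m :=
  [set q' | sources R m q' /\ tv_dist q' q <= eps].

(* Posterior mass on C is carried by these points only, so conditioning on C
   cannot concentrate at a source outside their closure; for a convex C with
   nonempty interior in the simplex they are dense in C. *)
Definition rational_sources (R : realType) (m : nat) (C : set 'rV[R]_m) :
    set 'rV[R]_m :=
  C `&` \bigcup_(n in [set n | (0 < n)%N]) n_sources R m n.

(* Main.v *)
Require Import Defs.
From HB Require Import structures.
From mathcomp Require Import all_boot all_order all_algebra finmap.
From mathcomp Require Import all_classical all_reals all_analysis.
From mathcomp Require Import ring lra zify.
Import Order.TTheory GRing.Theory Num.Theory.
Import numFieldNormedType.Exports.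
Local Open Scope classical_set_scope.
Local Open Scope ring_scope.

(** For a type with counts [k * c], the likelihood of a source [q] is, up to a
    factor independent of [q], the [k]-th power of the monomial
    [f q = \prod_i q_i ^ (c i)]; under the uniform prior the posterior on the
    [n]-sources is therefore proportional to [f q ^ k].  Since
    [L(q || nu) = ln (f q) / n0], the L-projection [qhat] is the unique maximizer
    of [f] on [Q] ([Lprojection_max]).  By compactness [f <= t < f qhat] on the
    part of [Q] outside the ball ([monomial_gap]).  There are at most
    [(n + 1) ^ m] sources in that part, so if some [n]-source of [Q] has
    [f >= t1 > t], the conditional posterior mass outside the ball is at most
    [(n + 1) ^ m * (t / t1) ^ k] ([cond_posterior_bounds]), which tends to 0
    because [n = k * n0] is linear in [k] ([polynomial_geometric]).

    The delicate point is that [Q] must contain [n]-sources with a large value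
    of [f] for every large [n] at which it contains [n]-sources at all, although
    the rational sources approximating [qhat] only live at multiples of their
    own denominator.  Convexity settles it ([n_sources_near]).  The count vectors
    [u] whose normalization lies in [Q] form an additive semigroup.  Let [w] be
    such a vector, with total [d] and with [w / d] close to [qhat].  For each
    residue modulo [d] that occurs among the totals, choose one vector [u] of the
    semigroup.  Every large total that occurs is the total of some [u + j w], and
    [u + j w] normalizes to a source that tends to [w / d].

    If [f qhat = 0], the posterior of [Q] vanishes for all [k > 0], and the limit
    is over an eventually empty set of indices. *)

Set Implicit Arguments.
Unset Strict Implicit.

(** * The likelihood monomial and the L-divergence *)

(** The likelihood of the source [q] without its multinomial coefficient. *)
Definition monomial (R : realType) (m : nat) (c : 'I_m -> nat)
    (q : 'rV[R]_m) : R :=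
  \prod_i q 0 i ^+ c i.

Lemma monomial_ge0 (R : realType) (m : nat) (c : 'I_m -> nat) (q : 'rV[R]_m) :
  sources R m q -> 0 <= monomial c q.
Proof. by move=> [q0 _]; apply: prodr_ge0 => i _; exact: exprn_ge0. Qed.

Lemma monomial_scale (R : realType) (m k : nat) (c : 'I_m -> nat)
    (q : 'rV[R]_m) :
  monomial (fun i => k * c i)%N q = monomial c q ^+ k.
Proof.
by rewrite /monomial -prodrXl; apply: eq_bigr => i _; rewrite mulnC exprM.
Qed.

Lemma monomial_continuous (R : realType) (m : nat) (c : 'I_m -> nat) :
  continuous (@monomial R m c).
Proof.
apply: continuous_big => [|i _ q]; first exact: mul_continuous.
apply: (@continuous_comp _ _ _ (fun q : 'rV[R]_m => q 0 i) (fun x => x ^+ c i)).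
  exact: coord_continuous.
exact: exprn_continuous.
Qed.

(** Both sides are [-oo] when some letter with a positive count has zero
    probability; letters with zero count contribute 0 on the left and a factor
    [q_i ^ 0 = 1] on the right, even if [q_i = 0]. *)
Lemma Ldiv_type_of (R : realType) (m n : nat) (c : 'I_m -> nat)
    (q : 'rV[R]_m) :
  (0 < n)%N -> sources R m q ->
  Ldiv q (type_of R n c) = ((n%:R^-1)%:E * lne (monomial c q)%:E)%E.
Proof.
move=> n0 [q0 _]; have n0R : 0 < n%:R^-1 :> R by rewrite invr_gt0 ltr0n.
rewrite /Ldiv; have [[i /andP[ci0 /eqP qi0]]|] :=
    pselect (exists i, (0 < c i)%N && (q 0 i == 0)).
  have -> : monomial c q = 0.
    by rewrite /monomial (bigD1 i)//= qi0 expr0n gtn_eqF// mul0r.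
  rewrite [in RHS]le0_lneNy// gt0_muleNy ?lte_fin//; apply/eqP.
  rewrite esum_eqNy; apply/existsP; exists i; rewrite !mxE qi0 le0_lneNy//.
  by rewrite gt0_muleNy// lte_fin mulr_gt0// ltr0n.
move=> h; have qi_gt0 i : (0 < c i)%N -> 0 < q 0 i.
  move=> ci0; rewrite lt_neqAle q0 andbT eq_sym; apply/negP => /eqP qi.
  by apply: h; exists i; rewrite ci0 qi eqxx.
have [mono0 ln_mono] : 0 < monomial c q /\
    ln (monomial c q) = \sum_i (c i)%:R * ln (q 0 i).
  rewrite /monomial; elim/big_rec2: _ => [|i s p _ [p0 sp]].
    by rewrite ln1 ltr01.
  have qc0 : 0 < q 0 i ^+ c i.
    by have [->|/qi_gt0/exprn_gt0//] := posnP (c i); rewrite expr0.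
  split; first exact: mulr_gt0.
  rewrite lnM ?posrE// sp; congr (_ + _).
  have [->|ci0] := posnP (c i); first by rewrite expr0 ln1 mul0r.
  by rewrite lnXn ?qi_gt0// mulr_natl.
rewrite lne_EFin// ln_mono -EFinM mulr_sumr -sumEFin; apply: eq_bigr => i _.
rewrite mxE; have [->|ci0] := posnP (c i); first by rewrite !mul0r mulr0 mul0e.
by rewrite lne_EFin ?qi_gt0// -EFinM; congr EFin; ring.
Qed.

Lemma Ldiv_le (R : realType) (m n : nat) (c : 'I_m -> nat) (q q' : 'rV[R]_m) :
  (0 < n)%N -> sources R m q -> sources R m q' ->
  (Ldiv q (type_of R n c) <= Ldiv q' (type_of R n c))%E =
  (monomial c q <= monomial c q').
Proof.
move=> n0 sq sq'; rewrite !Ldiv_type_of// lee_pmul2l ?lte_fin ?invr_gt0 ?ltr0n//.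
by rewrite lee_lne ?lee_fin// in_itv/= leey lee_fin monomial_ge0.
Qed.

(** A point of [Q] where the monomial is at least its value at [qhat] would be
    another L-projection. *)
Lemma Lprojection_max (R : realType) (m n : nat) (c : 'I_m -> nat)
    (Q : set 'rV[R]_m) (qhat : 'rV[R]_m) :
  (0 < n)%N -> Q `<=` sources R m ->
  Lprojection (type_of R n c) Q = [set qhat] ->
  Q qhat /\ forall q, Q q -> q != qhat -> monomial c q < monomial c qhat.
Proof.
move=> n0 Qs proj; have [Qqhat qhat_max] : Lprojection (type_of R n c) Q qhat.
  by rewrite proj.
split=> // q Qq; apply: contra_neqT; rewrite -leNgt => le_qhat_q.
suff : Lprojection (type_of R n c) Q q by rewrite proj.
split=> // q' Qq'; apply: le_trans (qhat_max q' Qq') _.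
by rewrite Ldiv_le//; apply: Qs.
Qed.

(** * The gap outside a ball around the projection *)

Lemma sources_bounded (R : realType) (m : nat) (q : 'rV[R]_m) i :
  sources R m q -> 0 <= q 0 i <= 1.
Proof.
move=> [q0 q1]; rewrite q0/= -q1 (bigD1 i)//= lerDl.
by apply: sumr_ge0 => j _; exact: q0.
Qed.

Lemma tv_dist_continuous (R : realType) (m : nat) (q : 'rV[R]_m) :
  continuous (fun q' => tv_dist q' q).
Proof.
have sum_cont : continuous (fun q' : 'rV[R]_m => \sum_i `|q' 0 i - q 0 i|).
  apply: continuous_big => [|i _ q']; first exact: add_continuous.
  apply: (@continuous_comp _ _ _ (fun q' : 'rV[R]_m => q' 0 i)
    (fun x => `|x - q 0 i|)); first exact: coord_continuous.
  by apply: cvg_norm; apply: cvgB; [exact: cvg_id|exact: cvg_cst].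
move=> q'; apply: (@continuous_comp _ _ _
  (fun q' : 'rV[R]_m => \sum_i `|q' 0 i - q 0 i|) (fun x => 2^-1 * x)).
  exact: sum_cont.
exact: mulrl_continuous.
Qed.

Lemma tv_distxx (R : realType) (m : nat) (q : 'rV[R]_m) : tv_dist q q = 0.
Proof. by rewrite /tv_dist big1 ?mulr0// => i _; rewrite subrr normr0. Qed.

(** The points of [Q] at distance at least [eps] from [qhat] form a compact set
    that avoids [qhat], so the monomial attains on it a maximum below its value
    at [qhat].  The nonstrict inequality [eps <= _] makes the set closed. *)
Lemma monomial_gap (R : realType) (m : nat) (c : 'I_m -> nat)
    (Q : set 'rV[R]_m) (qhat : 'rV[R]_m) (eps : R) :
  0 < eps -> Q `<=` sources R m -> closed Q ->
  (forall q, Q q -> q != qhat -> monomial c q < monomial c qhat) ->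
  0 < monomial c qhat ->
  exists2 t, 0 <= t < monomial c qhat &
    forall q, (Q `\` tv_ball qhat eps) q -> monomial c q <= t.
Proof.
move=> eps0 Qs Qclosed qhat_max qhat0.
pose K := Q `&` [set q | eps <= tv_dist q qhat].
have subK : Q `\` tv_ball qhat eps `<=` K.
  move=> q [Qq Bq]; split=> //=; rewrite leNgt; apply/negP => /ltW qeps.
  by apply: Bq; split=> //; exact: Qs.
have Kcompact : compact K.
  apply: (@subclosed_compact _ K
      [set q : 'rV[R]_m | forall i, [set` `[0, 1]] (q ord0 i)]).
  - apply: closedI => //.
    apply: (@preimage_closed _ _ (fun q : 'rV[R]_m => tv_dist q qhat)
      [set x | eps <= x]) => [q _|]; last exact: closed_ge.
    exact: tv_dist_continuous.
  - apply: (@rV_compact R m (fun=> [set` `[0, 1]])) => _.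
    exact: segment_compact.
  - by move=> q [/Qs sq _] i /=; rewrite in_itv/= sources_bounded.
have [K0|K0] := pselect (K !=set0); last first.
  exists 0; first by rewrite lexx.
  by move=> q /subK Kq; case: K0; exists q.
have [q /set_mem Kq q_max] := compact_EVT_max K0 Kcompact
  (continuous_subspaceT (@monomial_continuous R m c)).
exists (monomial c q); last by move=> p /subK Kp; apply: q_max; exact: mem_set.
have [Qq /= eps_q] := Kq; rewrite monomial_ge0/=; last exact: Qs.
apply: qhat_max => //; apply: contraTneq eps_q => ->.
by rewrite tv_distxx -ltNge.
Qed.

(** * The posterior as a sum over finitely many sources *)

(** The constant [K] gathers the multinomial coefficient, the uniform prior and
    the evidence, and cancels in conditional posteriors. *)
Lemma posterior_setE (R : realType) (m n : nat) (c : 'I_m -> nat) :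
  exists K : R, forall C : set 'rV[R]_m,
    posterior_set n c C = K * \sum_(q \in C `&` n_sources R m n) monomial c q.
Proof.
rewrite /posterior_set /posterior; set Z := \sum_(q' \in _) _.
exists ((n`!)%:R / (\prod_i (c i)`!)%N%:R / 'C(n + m - 1, m - 1)%:R / Z) => C.
rewrite mulr_fsumr; apply: eq_fsbigr => q; rewrite inE => -[_ nq].
by rewrite /likelihood /prior indicE mem_set// -/(monomial c q) mul1r; ring.
Qed.

Lemma card_n_sources (R : realType) (m n : nat) :
  (#|` fset_set (n_sources R m n)| <= n.+1 ^ m)%N.
Proof.
pose f (g : {ffun 'I_m -> 'I_n.+1}) : 'rV[R]_m :=
  type_of R n (fun i => g i : nat).
have -> : (n.+1 ^ m)%N = size (map f (enum {ffun 'I_m -> 'I_n.+1})).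
  by rewrite size_map -cardE card_ffun !card_ord.
apply: uniq_leq_size => [|q]; first exact: fset_uniq.
rewrite in_fset_set; last exact: finite_n_sources.
rewrite inE => -[u nu <-]; apply/mapP; exists [ffun i => inord (u i)].
  by rewrite mem_enum.
apply/rowP => i; rewrite !mxE ffunE inordK // ltnS -nu.
by rewrite (bigD1 i) //= leq_addr.
Qed.

Lemma sum_n_sources_le (R : realType) (m n : nat) (A : set 'rV[R]_m)
    (F : 'rV[R]_m -> R) (t : R) :
  0 <= t -> (forall q, A q -> F q <= t) ->
  \sum_(q \in A `&` n_sources R m n) F q <= n.+1%:R ^+ m * t.
Proof.
move=> t0 Ft; have finA : finite_set (A `&` n_sources R m n).
  by apply: finite_setIr; exact: finite_n_sources.
rewrite fsbig_finite//=.
apply: (@le_trans _ _ (\sum_(q <- fset_set (A `&` n_sources R m n)) t)).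
  rewrite big_seq [leRHS]big_seq; apply: ler_sum => q.
  by rewrite in_fset_set// inE => -[/Ft].
rewrite big_const_seq count_predT iter_addr_0 -[t *+ _]mulr_natl.
rewrite ler_wpM2r// -natrX ler_nat.
apply: leq_trans (@card_n_sources R m n); apply: fsubset_leq_card.
by rewrite -fset_set_sub//; exact: finite_n_sources.
Qed.

(** With [a = - ln rho], the exponential series gives
    [expR (k * a) >= (k * a) ^ m.+1 / m.+1`!], so [rho ^ k] decays at least as
    [k ^ - m.+1], one power more than what [(k * n + 1) ^ m] can compensate. *)
Lemma polynomial_geometric (R : realType) (n m : nat) (rho : R) :
  0 <= rho < 1 ->
  (k * n).+1%:R ^+ m * rho ^+ k @[k --> \oo] --> (0 : R).
Proof.
move=> /andP[]; rewrite le_eqVlt => /predU1P[<- _|rho0 rho1].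
  apply: cvg_near_cst; near=> k; rewrite expr0n gtn_eqF ?mulr0//.
  by near: k; exact: nbhs_infty_gt.
pose a := - ln rho; have a0 : 0 < a by rewrite oppr_gt0 ln_lt0// rho0.
pose C : R := n.+1%:R ^+ m * ((m.+1)`!)%:R / a ^+ m.+1.
apply: (@squeeze_cvgr _ _ _ _ (fun=> 0) (fun k => 2 * C * harmonic k)).
- near=> k; have k0 : (0 < k)%N by near: k; exact: nbhs_infty_gt.
  have k0R : 0 < k%:R :> R by rewrite ltr0n.
  rewrite mulr_ge0 ?exprn_ge0 ?(ltW rho0)//=.
  have le1 : (k * n).+1%:R ^+ m <= (k%:R * n.+1%:R) ^+ m :> R.
    by rewrite lerXn2r ?nnegrE// -natrM ler_nat; nia.
  have rhoE : rho ^+ k = (expR (k%:R * a))^-1.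
    by rewrite expRM_natl expRN lnK ?posrE// exprVn invrK.
  have le2 : (k%:R * a) ^+ m.+1 / (m.+1)`!%:R <= expR (k%:R * a).
    apply: le_trans _ (expR_ge1Dxn m _); first by rewrite lerDr.
    by rewrite mulr_ge0// ltW.
  have fact0 : 0 < (m.+1)`!%:R :> R by rewrite ltr0n fact_gt0.
  have le3 : rho ^+ k <= (m.+1)`!%:R / (k%:R * a) ^+ m.+1.
    rewrite rhoE -[leRHS]invrK lef_pV2 ?posrE ?expR_gt0//.
      by rewrite invf_div.
    by rewrite invr_gt0 divr_gt0// exprn_gt0// mulr_gt0.
  apply: le_trans (ler_pM _ _ le1 le3) _; rewrite ?exprn_ge0 ?(ltW rho0)//.
  have -> : (k%:R * n.+1%:R) ^+ m * ((m.+1)`!%:R / (k%:R * a) ^+ m.+1) = C / k%:R.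
    rewrite /C !exprMn [k%:R ^+ m.+1]exprSr; field.
    by rewrite !expf_neq0// gt_eqF.
  have C0 : 0 <= C by rewrite !mulr_ge0 ?invr_ge0 ?exprn_ge0 ?(ltW a0).
  rewrite [2 * C]mulrC -[leRHS]mulrA ler_wpM2l// /harmonic/= ler_pdivlMr ?ltr0n//.
  rewrite mulrC ler_pdivrMr// -natrM ler_nat; lia.
- exact: cvg_cst.
- rewrite -[X in _ --> X](mulr0 (2 * C)); apply: cvgMr; exact: cvg_harmonic.
Unshelve. all: by end_near. Qed.

(** * Approximation by sources of a given denominator *)

(** Adding count vectors amounts to a convex combination of the normalized
    vectors, here with weight [a / (a + j d)] on the first one. *)
Lemma convex_type_of (R : realType) (m a d j : nat) (u w : 'I_m -> nat)
    (Q : set 'rV[R]_m) :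
  (0 < a)%N -> (0 < d)%N -> convex_set Q ->
  Q (type_of R a u) -> Q (type_of R d w) ->
  Q (type_of R (a + j * d) (fun i => u i + j * w i)%N).
Proof.
move=> a0 d0 Qconvex Qu Qw.
have n0 : 0 < (a + j * d)%:R :> R by rewrite ltr0n; lia.
have lam0 : 0 <= a%:R / (a + j * d)%:R :> R by rewrite divr_ge0.
have lam1 : a%:R / (a + j * d)%:R <= 1 :> R.
  by rewrite ler_pdivrMr// mul1r ler_nat; lia.
have := Qconvex _ _ (Itv01 lam0 lam1) (mem_set Qu) (mem_set Qw).
move=> /set_mem; congr Q; apply/rowP => i; rewrite !mxE/= /unstable.onem.
have aR : a%:R != 0 :> R by rewrite pnatr_eq0 -lt0n.
have dR : d%:R != 0 :> R by rewrite pnatr_eq0 -lt0n.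
by move: n0 => /lt0r_neq0; rewrite !natrD !natrM => nR; field; rewrite nR aR dR.
Qed.

(** The difference is [(a w_i / d - u_i) / (a + j d)], whose numerator lies
    between [- a] and [a]. *)
Lemma type_of_dist (R : realType) (m a d j : nat) (u w : 'I_m -> nat) i :
  (0 < a)%N -> (0 < d)%N -> is_counts a u -> is_counts d w ->
  `|type_of R d w 0 i - type_of R (a + j * d) (fun i => u i + j * w i)%N 0 i|
    <= a%:R / (a + j * d)%:R.
Proof.
move=> a0 d0 ua wd; rewrite !mxE.
have n0 : 0 < (a + j * d)%:R :> R by rewrite ltr0n; lia.
have d0R : 0 < d%:R :> R by rewrite ltr0n.
have ui : (u i <= a)%N by rewrite -ua (bigD1 i)//= leq_addr.
have wi : (w i <= d)%N by rewrite -wd (bigD1 i)//= leq_addr.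
have -> : (w i)%:R / d%:R - (u i + j * w i)%:R / (a + j * d)%:R =
    (a%:R * ((w i)%:R / d%:R) - (u i)%:R) / (a + j * d)%:R :> R.
  move: n0 d0R => /lt0r_neq0 + /lt0r_neq0.
  by rewrite !natrD !natrM => nR dR; field; rewrite nR dR.
rewrite normf_div (gtr0_norm n0) ler_wpM2r ?invr_ge0//.
have w0 : 0 <= (w i)%:R / d%:R :> R by exact: divr_ge0.
have w1 : (w i)%:R / d%:R <= 1 :> R by rewrite ler_pdivrMr// mul1r ler_nat.
have u0 : 0 <= (u i)%:R :> R by [].
have u1 : (u i)%:R <= a%:R :> R by rewrite ler_nat.
by rewrite ler_norml; nra.
Qed.

(** The [n]-sources of [Q], when there are any, come arbitrarily close to a given
    rational source [r] of [Q], even if [n] is not a multiple of the denominator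
    [d] of [r]: a representative [a rho] of the residue [rho] of [n] modulo [d]
    is completed to [n] by copies of the counts of [r]. *)
Lemma n_sources_near (R : realType) (m d : nat) (Q : set 'rV[R]_m)
    (r : 'rV[R]_m) (delta : R) :
  (0 < d)%N -> convex_set Q -> (Q `&` n_sources R m d) r -> 0 < delta ->
  \forall n \near \oo, (Q `&` n_sources R m n) !=set0 ->
    exists2 q, (Q `&` n_sources R m n) q &
      forall i, `|r 0 i - q 0 i| < delta.
Proof.
move=> d0 Qconvex [Qr [w wd rE]] delta0; rewrite -rE in Qr *.
pose ok n := (Q `&` n_sources R m n) !=set0.
(* a rho is a denominator in the residue class rho for which Q has sources; its
   value is irrelevant when there is none. *)
have /choice[a aP] (rho : 'I_d) : exists a, forall n,
    (0 < n)%N -> ok n -> n = rho %[mod d] ->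
    [/\ (0 < a)%N, ok a & a = rho %[mod d]].
  have [[a [a0 oka arho]]|no] :=
    pselect (exists a, [/\ (0 < a)%N, ok a & a = rho %[mod d]]).
    by exists a.
  by exists 0%N => n n0 okn nrho; case: no; exists n.
pose A := \max_rho a rho.
near=> n => okn.
have n0 : (0 < n)%N by near: n; exact: nbhs_infty_gt.
have An : (A <= n)%N by near: n; exact: nbhs_infty_ge.
have Adelta : A%:R < delta * n%:R.
  rewrite -ltr_pdivrMl//; near: n; exact: nbhs_infty_gtr.
pose rho : 'I_d := Ordinal (ltn_pmod n d0).
have [|a0 [q [Qq [u ua qE]]] arho] := aP rho n n0 okn; first by rewrite modn_mod.
have aA : (a rho <= A)%N by exact: leq_bigmax.
pose j := ((n - a rho) %/ d)%N.
have nE : n = (a rho + j * d)%N.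
  rewrite divnK ?subnKC//; first exact: leq_trans An.
  by rewrite -eqn_mod_dvd ?(leq_trans aA)// arho modn_mod.
exists (type_of R n (fun i => u i + j * w i)%N); first split.
- by rewrite nE; apply: convex_type_of; rewrite ?qE.
- exists (fun i => u i + j * w i)%N => //=.
  by rewrite /is_counts big_split/= -big_distrr/= ua wd -nE.
- move=> i; rewrite nE; apply: le_lt_trans (type_of_dist R j i a0 d0 ua wd) _.
  rewrite -nE ltr_pdivrMr ?ltr0n//; apply: le_lt_trans Adelta.
  by rewrite ler_nat.
Unshelve. all: by end_near. Qed.

(** * Concentration of the posterior *)

(** The complement of [B] in [Q] carries at most [(n + 1) ^ m * t ^ k] of the
    total weight, and [q1] alone already carries at least [t1 ^ k]. *)
Lemma cond_posterior_bounds (R : realType) (m : nat) (c : 'I_m -> nat)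
    (Q B : set 'rV[R]_m) (k n : nat) (t t1 : R) (q1 : 'rV[R]_m) :
  Q `<=` sources R m -> 0 <= t -> 0 < t1 ->
  (forall q, (Q `\` B) q -> monomial c q <= t) ->
  (Q `&` n_sources R m n) q1 -> t1 <= monomial c q1 ->
  0 < posterior_set n (fun i => (k * c i)%N) Q ->
  1 - n.+1%:R ^+ m * (t / t1) ^+ k
    <= cond_posterior n (fun i => (k * c i)%N) B Q <= 1.
Proof.
move=> Qs t0 t10 tP [Qq1 nq1] le_t1; rewrite /cond_posterior.
have [K postE] := posterior_setE R n (fun i => k * c i)%N.
rewrite !postE; set S := \sum_(q \in Q `&` _) _ => KS0.
set SB := \sum_(q \in B `&` Q `&` _) _.
pose N := n_sources R m n.
have finQN : finite_set (Q `&` N) by apply: finite_setIr; exact: finite_n_sources.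
have mono0 q : Q q -> 0 <= monomial (fun i => k * c i)%N q.
  by move=> /Qs; exact: monomial_ge0.
pose SD := \sum_(q \in (Q `\` B) `&` N) monomial (fun i => k * c i)%N q.
(* Split Q into its parts inside and outside B. *)
have SE : S = SB + SD.
  rewrite /S (fsbigID B)//=; congr (_ + _); apply: eq_fsbigl.
    by rewrite setIAC [B `&` Q]setIC.
  by rewrite setDE setIAC.
have SD0 : 0 <= SD by apply: fsumr_ge0 => q [[/mono0]].
have SD_le : SD <= n.+1%:R ^+ m * t ^+ k.
  apply: sum_n_sources_le; first exact: exprn_ge0.
  move=> q Dq; rewrite monomial_scale lerXn2r ?nnegrE ?tP//.
  by apply: monomial_ge0; apply: Qs; case: Dq.
have S_ge : t1 ^+ k <= S.
  apply: (@le_trans _ _ (monomial (fun i => k * c i)%N q1)).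
    rewrite monomial_scale lerXn2r// nnegrE ?(ltW t10)//.
    exact: le_trans (ltW t10) le_t1.
  rewrite /S (fsbigD1 q1)//= lerDl; apply: fsumr_ge0 => q [[Qq _] _].
  exact: mono0.
have S0 : 0 < S by apply: lt_le_trans S_ge; exact: exprn_gt0.
have K0 : K != 0 by apply: contraTneq KS0 => ->; rewrite mul0r ltxx.
have -> : K * SB / (K * S) = 1 - SD / S.
  have -> : SB = S - SD by rewrite SE addrK.
  by field; rewrite K0 gt_eqF.
rewrite gerBl divr_ge0 ?(ltW S0)// andbT lerB// expr_div_n mulrA.
apply: (@le_trans _ _ (SD / t1 ^+ k)).
  by rewrite ler_wpM2l// lef_pV2 ?posrE ?exprn_gt0.
by rewrite ler_wpM2r// invr_ge0 exprn_ge0// ltW.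
Qed.

Unset Implicit Arguments.

Theorem mainTheorem3 (R : realType) (m n0 : nat) (c : 'I_m -> nat)
    (Q : set 'rV[R]_m) (qhat : 'rV[R]_m)
    (n0_gt0 : (0 < n0)%N) (c_type : is_counts n0 c)
    (Q_sources : Q `<=` sources R m)
    (Q_convex : convex_set Q) (Q_closed : closed Q)
    (Q_rare : ~ Q (type_of R n0 c))
    (qhat_proj : Lprojection (type_of R n0 c) Q = [set qhat])
    (qhat_rational_limit : closure (rational_sources Q) qhat) :
  forall eps : R, 0 < eps ->
    cond_posterior (k * n0) (fun i => (k * c i)%N) (tv_ball qhat eps) Q
      @[k --> within
          [set k : nat |
            0 < posterior_set (k * n0) (fun i => (k * c i)%N) Q] \oo]
      --> (1 : R).
Proof.
move=> eps eps0.
have [Qqhat qhat_max] := Lprojection_max n0_gt0 Q_sources qhat_proj.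
have := monomial_ge0 c (Q_sources _ Qqhat).
rewrite le_eqVlt => /predU1P[qhat0|qhat_gt0].
  have Q0 q : Q q -> monomial c q = 0.
    move=> Qq; apply/eqP; rewrite eq_le monomial_ge0 ?andbT; last exact: Q_sources.
    have [->|/(qhat_max _ Qq)] := eqVneq q qhat; first by rewrite -qhat0.
    by rewrite -qhat0 => /ltW.
  apply: cvg_near_cst; rewrite near_withinE; near=> k => /=.
  have k0 : (0 < k)%N by near: k; exact: nbhs_infty_gt.
  have [K ->] := posterior_setE R (k * n0) (fun i => k * c i)%N.
  rewrite fsbig1 ?mulr0 ?ltxx// => q [Qq _].
  by rewrite monomial_scale Q0// expr0n gtn_eqF.
have [t /andP[t_ge0 t_lt] tP] :=
  monomial_gap eps0 Q_sources Q_closed qhat_max qhat_gt0.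
pose t1 := (t + monomial c qhat) / 2.
have t_t1 : t < t1 by rewrite midf_lt.
have t1_lt : t1 < monomial c qhat by rewrite midf_lt.
have t1_gt0 : 0 < t1 := le_lt_trans t_ge0 t_t1.
have above (q : 'rV[R]_m) : t1 < monomial c q ->
    nbhs q [set q' | t1 < monomial c q'].
  move=> t1q; apply: (@monomial_continuous R m c q [set x | t1 < x]).
  by apply: open_nbhs_nbhs; split=> //; exact: open_gt.
(* Since qhat is a limit of rational sources of Q, one of them has its monomial
   above the threshold t1. *)
have [r [[Qr [d d0 nr]] /= t1_r]] := qhat_rational_limit _ (above _ t1_lt).
have /nbhs_ballP[delta /= delta0 ball_sub] := above _ t1_r.
have [N _ near_r] := n_sources_near d0 Q_convex (conj Qr nr) delta0.
apply: (@squeeze_cvgr _ _ _ _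
  (fun k => 1 - (k * n0).+1%:R ^+ m * (t / t1) ^+ k) (fun=> 1)).
- rewrite near_withinE; near=> k => /= post0.
  have Nk : (N <= k * n0)%N.
    apply: leq_trans (leq_pmulr _ n0_gt0); near: k; exact: nbhs_infty_ge.
  have [|q [Qq nq] q_near] := near_r _ Nk.
    have [K postE] := posterior_setE R (k * n0) (fun i => k * c i)%N.
    apply: contrapT => no; move: post0; rewrite postE fsbig1 ?mulr0 ?ltxx//.
    by move=> q Qnq; case: no; exists q.
  apply: (@cond_posterior_bounds _ _ _ _ _ k _ _ _ _ Q_sources t_ge0 t1_gt0 tP
    (conj Qq nq)) => //.
  apply/ltW/ball_sub; split=> // i j; rewrite ord1; exact: q_near.
- rewrite -[X in _ --> X]subr0; apply: cvgB; first exact: cvg_cst.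
  apply: cvg_trans (@polynomial_geometric R n0 m (t / t1) _).
    by apply: cvg_app; exact: cvg_within.
  by rewrite divr_ge0 ?(ltW t1_gt0)//= ltr_pdivrMr// mul1r.
- exact: cvg_cst.
Unshelve. all: by end_near. Qed.
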